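(* Let $I\in\mathbb{S}$, $q\in\mathbb{B}$ and let $k\ge0$ be an integer. Then $$Q_k(q)=-\frac{1}{2(k+1)(k+2)}\int_{\mathbb{B}_I}K_{BF}^{\mathbb{B}}(q,r)\,r^{k+2}\,d\sigma_I(r).$$
   Context: $\mathbb{H}$ denotes the quaternions, $\mathbb{S}=\{I\in\mathbb{H}:I^2=-1\}$, $\mathbb{C}_I=\mathbb{R}+\mathbb{R}I$, $\mathbb{B}=\{|q|<1\}\subset\mathbb{H}$, $\mathbb{B}_I=\mathbb{B}\cap\mathbb{C}_I$. $d\sigma_I=\frac1\pi dx\,dy$ is the normalized Lebesgue measure on $\mathbb{B}_I$. $Q_k(q)=\sum_{j=0}^k\frac{2(k-j+1)}{(k+1)(k+2)}q^{k-j}\overline q^{\,j}$. The slice Bergman kernel of $\mathbb{B}$ is $K_{\mathbb{B}}(q,r)=\sum_{k=0}^\infty(k+1)q^k\overline r^{\,k}$ and the Bergman-Fueter kernel is $K_{BF}^{\mathbb{B}}(q,r)=\Delta K_{\mathbb{B}}(q,r)$, $\Delta$ being the Laplacian on $\mathbb{R}^4\cong\mathbb{H}$ in the variable $q$. *)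

(* Defs.v *)
From HB Require Import structures.
From mathcomp Require Import all_boot all_order all_algebra.
From mathcomp Require Import all_classical all_reals all_analysis.
From mathcomp Require Import ring.

Set Implicit Arguments.
Unset Strict Implicit.
Unset Printing Implicit Defensive.

Import Order.TTheory GRing.Theory Num.Theory.
Import numFieldNormedType.Exports.

Local Open Scope classical_set_scope.
Local Open Scope ring_scope.

(* The quaternion a + b i + c j + d k is the row vector (a, b, c, d), so that
   the real vector space structure, the topology, the series and the
   directional derivatives of H ~ R^4 are those of 'rV[R]_4.
   Beware: `|q| is the sup norm of this vector; the modulus of q is qnorm q. *)
Definition quat (R : realType) : Type := 'rV[R]_4.

HB.instance Definition _ (R : realType) :=
  NormedModule.copy (quat R) 'rV[R]_4.
HB.instance Definition _ (R : realType) :=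
  CompletePseudoMetric.copy (quat R) 'rV[R]_4.

Definition mkquat (R : realType) (a b c d : R) : quat R :=
  \row_(i < 4) [:: a; b; c; d]`_i.

Section QuatRing.
Variable R : realType.
Implicit Types x y z : quat R.

Lemma mkquatE (a b c d : R) :
  [/\ mkquat a b c d 0 0 = a, mkquat a b c d 0 1 = b,
      mkquat a b c d 0 2 = c & mkquat a b c d 0 3 = d].
Proof. by split; rewrite mxE. Qed.

Lemma quatP x y :
  x 0 0 = y 0 0 -> x 0 1 = y 0 1 -> x 0 2 = y 0 2 -> x 0 3 = y 0 3 -> x = y.
Proof.
move=> h0 h1 h2 h3; apply/rowP => -[[|[|[|[|//]]]] lti].
- by rewrite (_ : Ordinal lti = 0) //; apply/val_inj.
- by rewrite (_ : Ordinal lti = 1) //; apply/val_inj.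
- by rewrite (_ : Ordinal lti = 2) //; apply/val_inj.
- by rewrite (_ : Ordinal lti = 3) //; apply/val_inj.
Qed.

Definition qone : quat R := mkquat 1 0 0 0.

Definition qmul x y : quat R := mkquat
  (x 0 0 * y 0 0 - x 0 1 * y 0 1 - x 0 2 * y 0 2 - x 0 3 * y 0 3)
  (x 0 0 * y 0 1 + x 0 1 * y 0 0 + x 0 2 * y 0 3 - x 0 3 * y 0 2)
  (x 0 0 * y 0 2 - x 0 1 * y 0 3 + x 0 2 * y 0 0 + x 0 3 * y 0 1)
  (x 0 0 * y 0 3 + x 0 1 * y 0 2 - x 0 2 * y 0 1 + x 0 3 * y 0 0).

Let qE := (fun a b c d => let: And4 p _ _ _ := mkquatE a b c d in p,
           fun a b c d => let: And4 _ p _ _ := mkquatE a b c d in p,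
           fun a b c d => let: And4 _ _ p _ := mkquatE a b c d in p,
           fun a b c d => let: And4 _ _ _ p := mkquatE a b c d in p).

Fact qaddE x y i j : (x + y) i j = x i j + y i j. Proof. exact: mxE. Qed.

Fact qmulA : associative qmul.
Proof. by move=> x y z; apply: quatP; rewrite /qmul !qE; ring. Qed.

Fact qmul1q : left_id qone qmul.
Proof. by move=> x; apply: quatP; rewrite /qmul /qone !qE; ring. Qed.

Fact qmulq1 : right_id qone qmul.
Proof. by move=> x; apply: quatP; rewrite /qmul /qone !qE; ring. Qed.

Fact qmulDl : left_distributive qmul +%R.
Proof.
by move=> x y z; apply: quatP; rewrite /qmul !qaddE !qE ?qaddE; ring.
Qed.

Fact qmulDr : right_distributive qmul +%R.
Proof.
by move=> x y z; apply: quatP; rewrite /qmul !qaddE !qE ?qaddE; ring.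
Qed.

Fact qone_neq0 : qone != 0.
Proof.
apply/eqP => /(congr1 (fun x : quat R => x 0 0)) /eqP.
by rewrite /qone qE mxE oner_eq0.
Qed.

HB.instance Definition _ := GRing.Zmodule_isNzRing.Build (quat R)
  qmulA qmul1q qmulq1 qmulDl qmulDr qone_neq0.

Fact qmulE x y : x * y = qmul x y. Proof. by []. Qed.

Fact qscaleE (a : R) x i j : (a *: x) i j = a * x i j. Proof. exact: mxE. Qed.

Fact qscaleAl (a : R) x y : a *: (x * y) = (a *: x) * y.
Proof.
by apply: quatP; rewrite qscaleE !qmulE /qmul !qE !qscaleE; ring.
Qed.

HB.instance Definition _ := GRing.Lmodule_isLalgebra.Build R (quat R) qscaleAl.

Fact qscaleAr (a : R) x y : a *: (x * y) = x * (a *: y).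
Proof.
by apply: quatP; rewrite qscaleE !qmulE /qmul !qE !qscaleE; ring.
Qed.

HB.instance Definition _ := GRing.Lalgebra_isAlgebra.Build R (quat R) qscaleAr.

End QuatRing.

Section SliceBergman.
Variable R : realType.
Implicit Types (I q r : quat R) (f : quat R -> quat R).

Definition qconj q : quat R := mkquat (q 0 0) (- q 0 1) (- q 0 2) (- q 0 3).

Definition qnorm q : R := Num.sqrt (\sum_(i < 4) q 0 i ^+ 2).

Definition qball : set (quat R) := [set q | qnorm q < 1].

Definition imag_units : set (quat R) := [set I | I ^+ 2 = - 1].

Definition slice_pt I (z : R * R) : quat R := z.1 *: 1 + z.2 *: I.

Definition slice I : set (quat R) := range (slice_pt I).

Definition slice_ball I : set (quat R) := qball `&` slice I.

(* Integral over B_I of an H-valued function with respect to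
   d sigma_I = (1/pi) dx dy, taken componentwise, in the coordinates
   (x, y) |-> x + y I of C_I. *)
Definition slice_integral I f : quat R :=
  \row_(i < 4) (pi^-1 *
    \int[(lebesgue_measure \x lebesgue_measure)%E]_(z in
        slice_pt I @^-1` slice_ball I) (f (slice_pt I z) 0 i)).

Definition laplacian f q : quat R :=
  \sum_(i < 4) 'D_(delta_mx 0 i : quat R)
                 (fun p => 'D_(delta_mx 0 i : quat R) f p) q.

Definition bergman_kernel q r : quat R :=
  limn (series (fun k => (k.+1%:R : R) *: (q ^+ k * qconj r ^+ k))).

Definition bergman_fueter_kernel q r : quat R :=
  laplacian (fun p => bergman_kernel p r) q.

Definition Qpoly (k : nat) q : quat R :=
  \sum_(0 <= j < k.+1) ((2 * (k - j + 1))%:R / (k.+1 * k.+2)%:R : R) *: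
    (q ^+ (k - j) * qconj q ^+ j).

End SliceBergman.

(* Main.v *)
Require Import Defs.
From mathcomp Require Import all_boot all_order all_algebra.
From mathcomp Require Import all_classical all_reals all_analysis.
From mathcomp Require Import measurable_realfun ring lra.
Set Implicit Arguments.
Unset Strict Implicit.
Unset Printing Implicit Defensive.
Import Order.TTheory GRing.Theory Num.Theory.
Import numFieldNormedType.Exports.
Local Open Scope classical_set_scope.
Local Open Scope ring_scope.

(** The idea is to expand the Bergman-Fueter kernel in powers of [qconj r] and
    to let the orthogonality of the monomials on the disc select one term.

    The Laplacian in [q] of [q ^+ k.+2] is [- 2 (k+1) (k+2) Q_k(q)]
    ([sum_dpow2_Qpoly]): by the Leibniz rule, it is a sum of products in which
    two of the factors [q] have been replaced by the same element [e] of the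
    basis [1, i, j, k], and the sum of the [e x e] over the basis is
    [- 2 qconj x] ([sum_basis_conj]).  The power series of the slice Bergman
    kernel may be differentiated twice termwise inside the ball, because the
    Taylor remainders of [p ^+ n] have a geometric bound
    ([qnorm_taylor1_le], [qnorm_taylor2_le], [is_derive_series]).  Hence
    [K_BF(q, r)] is the sum over [n] of [(n+1) (Delta q ^+ n) qconj r ^+ n]
    ([bergman_fueter_series]).

    On the disc of a slice, write [m a b] for the integral of
    [w ^+ a * qconj w ^+ b].  By the divergence theorem, the derivative of a
    function that vanishes on the circle has integral zero
    ([integral_disc_pdx], [integral_disc_pdy]).  The two Wirtinger derivatives
    of [(1 - w * qconj w) * w ^+ a * qconj w ^+ b] thus give
    [(a+1) m a b = (a+2) m a.+1 b.+1] and [(b+1) m a b = (b+2) m a.+1 b.+1]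
    ([momentSl], [momentSr]).  For [a] and [b] distinct these two relations
    force [m a b = 0]; for [a = b] they reduce [m a a] to the area of the
    disc, so that [(a+1) m a a = pi].

    The coefficients of the series are bounded by a summable sequence that does
    not depend on [r], so dominated convergence allows termwise integration
    against [r ^+ k.+2] ([qint_series]).  Only [n = k+2] survives: the
    normalized integral is [(k+3)^-1 (k+3) (Delta q ^+ k.+2)], which is
    [- 2 (k+1) (k+2) Q_k(q)]. *)

(** * Quaternion arithmetic *)

Section QuatAlgebra.
Context {R : realType}.
Implicit Types x y p q v : quat R.

Lemma sum4 (V : nmodType) (F : 'I_4 -> V) :
  \sum_(i < 4) F i = F 0 + F 1 + F 2 + F 3.
Proof.
rewrite !big_ord_recl big_ord0 addr0 !addrA.
by congr (F _ + F _ + F _ + F _); apply/val_inj.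
Qed.

Lemma quatM0 x y : (x * y) 0 0 =
  x 0 0 * y 0 0 - x 0 1 * y 0 1 - x 0 2 * y 0 2 - x 0 3 * y 0 3.
Proof. by rewrite qmulE mxE. Qed.
Lemma quatM1 x y : (x * y) 0 1 =
  x 0 0 * y 0 1 + x 0 1 * y 0 0 + x 0 2 * y 0 3 - x 0 3 * y 0 2.
Proof. by rewrite qmulE mxE. Qed.
Lemma quatM2 x y : (x * y) 0 2 =
  x 0 0 * y 0 2 - x 0 1 * y 0 3 + x 0 2 * y 0 0 + x 0 3 * y 0 1.
Proof. by rewrite qmulE mxE. Qed.
Lemma quatM3 x y : (x * y) 0 3 =
  x 0 0 * y 0 3 + x 0 1 * y 0 2 - x 0 2 * y 0 1 + x 0 3 * y 0 0.
Proof. by rewrite qmulE mxE. Qed.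
Definition quatM := (quatM0, quatM1, quatM2, quatM3).

Lemma quat1E : [/\ (1 : quat R) 0 0 = 1, (1 : quat R) 0 1 = 0,
  (1 : quat R) 0 2 = 0 & (1 : quat R) 0 3 = 0].
Proof. exact: mkquatE. Qed.
Lemma quat1_0 : (1 : quat R) 0 0 = 1. Proof. by have [] := quat1E. Qed.
Lemma quat1_1 : (1 : quat R) 0 1 = 0. Proof. by have [] := quat1E. Qed.
Lemma quat1_2 : (1 : quat R) 0 2 = 0. Proof. by have [] := quat1E. Qed.
Lemma quat1_3 : (1 : quat R) 0 3 = 0. Proof. by have [] := quat1E. Qed.
Definition quat1 := (quat1_0, quat1_1, quat1_2, quat1_3).

Lemma qconj0 x : qconj x 0 0 = x 0 0. Proof. by rewrite mxE. Qed.
Lemma qconj1 x : qconj x 0 1 = - x 0 1. Proof. by rewrite mxE. Qed.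
Lemma qconj2 x : qconj x 0 2 = - x 0 2. Proof. by rewrite mxE. Qed.
Lemma qconj3 x : qconj x 0 3 = - x 0 3. Proof. by rewrite mxE. Qed.
Definition qconjE := (qconj0, qconj1, qconj2, qconj3).

Lemma quatD x y i j : (x + y) i j = x i j + y i j. Proof. exact: mxE. Qed.
Lemma quatN x i j : (- x) i j = - x i j. Proof. exact: mxE. Qed.
Lemma quatZ (a : R) x i j : (a *: x) i j = a * x i j. Proof. exact: mxE. Qed.
Lemma quat0 i j : (0 : quat R) i j = 0. Proof. exact: mxE. Qed.
Definition quatE := (quatM, qconjE, quatD, quatN, quatZ, quat1, quat0).

Lemma quat_coordP x y : (forall i, x 0 i = y 0 i) -> x = y.
Proof. by move=> xy; apply/rowP. Qed.

Lemma qnorm_sqr x :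
  qnorm x ^+ 2 = x 0 0 ^+ 2 + x 0 1 ^+ 2 + x 0 2 ^+ 2 + x 0 3 ^+ 2.
Proof.
rewrite /qnorm sqr_sqrtr ?sum4//.
by rewrite !addr_ge0 ?sqr_ge0.
Qed.

Lemma qnorm_ge0 x : 0 <= qnorm x. Proof. exact: sqrtr_ge0. Qed.

Lemma eq_qnorm x (a : R) : 0 <= a -> qnorm x ^+ 2 = a ^+ 2 -> qnorm x = a.
Proof.
by move=> a0 /eqP; rewrite eqrXn2 ?qnorm_ge0// => /eqP.
Qed.

Lemma qnormM x y : qnorm (x * y) = qnorm x * qnorm y.
Proof.
apply: eq_qnorm; first by rewrite mulr_ge0 ?qnorm_ge0.
by rewrite exprMn !qnorm_sqr !quatE; ring.
Qed.

Lemma qnorm1 : qnorm (1 : quat R) = 1.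
Proof. by apply: eq_qnorm => //; rewrite qnorm_sqr !quatE; ring. Qed.

Lemma qnormX x n : qnorm (x ^+ n) = qnorm x ^+ n.
Proof.
by elim: n => [|n IH]; rewrite ?expr0 ?qnorm1// !exprS qnormM IH.
Qed.

Lemma qnorm_conj x : qnorm (qconj x) = qnorm x.
Proof.
by apply: eq_qnorm; rewrite ?qnorm_ge0// !qnorm_sqr !quatE; ring.
Qed.

Lemma qnormZ (a : R) x : qnorm (a *: x) = `|a| * qnorm x.
Proof.
apply: eq_qnorm; first by rewrite mulr_ge0 ?qnorm_ge0.
by rewrite exprMn real_normK ?num_real// !qnorm_sqr !quatE; ring.
Qed.

Lemma qnorm0 : qnorm (0 : quat R) = 0.
Proof. by rewrite -(scale0r (0 : quat R)) qnormZ normr0 mul0r. Qed.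

Lemma ler_coord_qnorm x i : `|x 0 i| <= qnorm x.
Proof.
rewrite -ler_sqr ?nnegrE ?qnorm_ge0// real_normK ?num_real//.
rewrite /qnorm sqr_sqrtr; last by apply: sumr_ge0 => j _; rewrite sqr_ge0.
by rewrite (bigD1 i)//= lerDl sumr_ge0// => j _; rewrite sqr_ge0.
Qed.

Lemma ler_norm_qnorm x : `|x| <= qnorm x.
Proof.
rewrite /Num.norm/= mx_normrE; apply: bigmax_le; first exact: qnorm_ge0.
by case=> i j _; rewrite /= ord1; exact: ler_coord_qnorm.
Qed.

(** Cauchy-Schwarz comes for free: the scalar product of [x] and [y] is the
    real part of [x * qconj y], whose modulus is [qnorm x * qnorm y]. *)
Lemma qnormD x y : qnorm (x + y) <= qnorm x + qnorm y.
Proof.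
rewrite -ler_sqr ?nnegrE ?addr_ge0 ?qnorm_ge0//.
have := le_trans (ler_norm _) (ler_coord_qnorm (x * qconj y) 0).
rewrite qnormM qnorm_conj sqrrD !qnorm_sqr !quatE.
by move=> h; lra.
Qed.

Lemma qnorm_delta i : qnorm (delta_mx 0 i : quat R) = 1.
Proof.
apply: eq_qnorm => //; rewrite /qnorm sqr_sqrtr; last first.
  by apply: sumr_ge0 => j _; rewrite sqr_ge0.
rewrite (bigD1 i)//= mxE !eqxx big1 ?addr0// => j ji.
by rewrite mxE (negbTE ji) andbF expr0n.
Qed.

Lemma qconj_comm x : x * qconj x = qconj x * x.
Proof. by apply: quatP; rewrite !quatE; ring. Qed.

Lemma qconjX x n : qconj (x ^+ n) = qconj x ^+ n.
Proof.
elim: n => [|n IH]; first by apply: quatP; rewrite !expr0 !quatE ?oppr0.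
by rewrite exprS exprSr -IH; apply: quatP; rewrite !quatE; ring.
Qed.

(** For an imaginary unit [e] of the basis, [e * x * e] is [- x] when [x] is in
    the span of [1] and [e], and [x] when [x] is orthogonal to both.  The real
    part of [x] is thus counted [1 - 3] times, and each of its imaginary
    coordinates [1 - 1 + 2] times. *)
Lemma sum_basis_conj x :
  \sum_(i < 4) (delta_mx 0 i : quat R) * x * (delta_mx 0 i : quat R)
  = (- 2) *: qconj x.
Proof.
rewrite sum4; apply: quatP; rewrite !quatE !mxE/=; ring.
Qed.

End QuatAlgebra.

(** * Directional derivatives of the powers of a quaternion *)

Section PowerDerivatives.
Context {R : realType}.
Implicit Types p q v : quat R.

(** The coefficient of [t] in [(p + t *: v) ^+ n]. *)
Fixpoint dpow1 v p n : quat R :=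
  if n is m.+1 then dpow1 v p m * p + p ^+ m * v else 0.

(** Twice the coefficient of [t ^+ 2] in [(p + t *: v) ^+ n]. *)
Fixpoint dpow2 v p n : quat R :=
  if n is m.+1 then dpow2 v p m * p + 2 *: (dpow1 v p m * v) else 0.

Definition taylor1 v p (t : R) n : quat R :=
  (p + t *: v) ^+ n - p ^+ n - t *: dpow1 v p n.

Definition taylor2 v p (t : R) n : quat R :=
  dpow1 v (p + t *: v) n - dpow1 v p n - t *: dpow2 v p n.

Lemma taylor1S v p t n : taylor1 v p t n.+1 =
  taylor1 v p t n * (p + t *: v) + t ^+ 2 *: (dpow1 v p n * v).
Proof.
rewrite /taylor1 /= !exprSr.
move: (dpow1 v p n) (p ^+ n) ((p + t *: v) ^+ n) => D P T.
by apply: quatP; rewrite !quatE; ring.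
Qed.

Lemma taylor2S v p t n : taylor2 v p t n.+1 =
  taylor2 v p t n * (p + t *: v)
  + (t ^+ 2 *: (dpow2 v p n * v) + taylor1 v p t n * v).
Proof.
rewrite /taylor2 /taylor1 /=.
move: (dpow1 v p n) (dpow2 v p n) (p ^+ n) (dpow1 v (p + t *: v) n)
  ((p + t *: v) ^+ n) => D1 D2 P E T.
by apply: quatP; rewrite !quatE; ring.
Qed.

Section Bounds.
Variables (rho d : R) (v : quat R).
Hypotheses (rho0 : 0 <= rho) (d0 : 0 <= d) (v1 : qnorm v = 1).

Let s := rho + d.
Let s0 : 0 <= s. Proof. exact: addr_ge0. Qed.

(** The recursion [z = x * p + y] with [qnorm p <= rho] multiplies bounds by
    [rho]; the surplus [d] in the ratio [s = rho + d] absorbs the term [y].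
    This gives geometric bounds for all the sequences below, whose exact growth
    would involve powers of [n]. *)
Lemma qnorm_rec_le (c C : R) p (x y z : quat R) n : 0 <= c -> qnorm p <= rho ->
  z = x * p + y -> c * qnorm x <= C * s ^+ n -> c * qnorm y <= C * d * s ^+ n ->
  c * qnorm z <= C * s ^+ n.+1.
Proof.
move=> c0 pr -> xC yC.
have -> : C * s ^+ n.+1 = C * s ^+ n * rho + C * d * s ^+ n.
  by rewrite exprSr /s; ring.
apply: le_trans (ler_wpM2l c0 (qnormD _ _)) _.
rewrite mulrDr lerD// qnormM mulrA.
apply: le_trans (ler_wpM2l _ pr) _; first by rewrite mulr_ge0 ?qnorm_ge0.
exact: ler_wpM2r.
Qed.

Lemma qnorm_dpow1_le p n : qnorm p <= rho -> d * qnorm (dpow1 v p n) <= s ^+ n.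
Proof.
move=> pr; elim: n => [|n IH].
  by rewrite qnorm0 mulr0 expr0.
rewrite -[leRHS]mul1r; apply: (qnorm_rec_le _ pr) => //.
  by rewrite mul1r.
rewrite mul1r qnormM v1 mulr1 qnormX ler_wpM2l// lerXn2r ?nnegrE ?qnorm_ge0//.
by rewrite (le_trans pr)// /s lerDl.
Qed.

Lemma qnorm_dpow2_le p n : qnorm p <= rho ->
  d ^+ 2 * qnorm (dpow2 v p n) <= 2 * s ^+ n.
Proof.
move=> pr; elim: n => [|n IH]; first by rewrite qnorm0 mulr0 expr0 mulr1.
apply: (qnorm_rec_le _ pr) => //; first exact: exprn_ge0.
rewrite qnormZ qnormM v1 mulr1 ger0_norm//.
have -> : d ^+ 2 * (2 * qnorm (dpow1 v p n)) = 2 * d * (d * qnorm (dpow1 v p n)).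
  by ring.
by rewrite ler_wpM2l ?qnorm_dpow1_le// mulr_ge0.
Qed.

Lemma qnorm_taylor1_le p t n : qnorm p <= rho -> qnorm (p + t *: v) <= rho ->
  d ^+ 2 * qnorm (taylor1 v p t n) <= t ^+ 2 * s ^+ n.
Proof.
move=> pr ptr; elim: n => [|n IH].
  rewrite /taylor1 /= !expr0 subrr scaler0 subr0 qnorm0 mulr0 mulr1.
  exact: sqr_ge0.
apply: (qnorm_rec_le _ ptr); [exact: exprn_ge0|exact: taylor1S|exact: IH|].
rewrite qnormZ qnormM v1 mulr1 ger0_norm ?sqr_ge0//.
have -> : d ^+ 2 * (t ^+ 2 * qnorm (dpow1 v p n)) =
  t ^+ 2 * d * (d * qnorm (dpow1 v p n)) by ring.
by rewrite ler_wpM2l ?qnorm_dpow1_le// mulr_ge0 ?sqr_ge0.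
Qed.

Lemma qnorm_taylor2_le p t n : qnorm p <= rho -> qnorm (p + t *: v) <= rho ->
  d ^+ 3 * qnorm (taylor2 v p t n) <= 3 * t ^+ 2 * s ^+ n.
Proof.
move=> pr ptr; elim: n => [|n IH].
  rewrite /taylor2 /= subrr scaler0 subr0 qnorm0 mulr0 expr0 mulr1.
  by rewrite mulr_ge0 ?sqr_ge0.
apply: (qnorm_rec_le _ ptr); [exact: exprn_ge0|exact: taylor2S|exact: IH|].
apply: le_trans (ler_wpM2l _ (qnormD _ _)) _; first exact: exprn_ge0.
rewrite qnormZ !qnormM v1 !mulr1 ger0_norm ?sqr_ge0//.
have -> : d ^+ 3 * (t ^+ 2 * qnorm (dpow2 v p n) + qnorm (taylor1 v p t n)) =
  t ^+ 2 * d * (d ^+ 2 * qnorm (dpow2 v p n)) +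
  d * (d ^+ 2 * qnorm (taylor1 v p t n)) by ring.
have -> : 3 * t ^+ 2 * d * s ^+ n =
  t ^+ 2 * d * (2 * s ^+ n) + d * (t ^+ 2 * s ^+ n) by ring.
rewrite lerD// ler_wpM2l// ?qnorm_dpow2_le ?qnorm_taylor1_le//.
by rewrite mulr_ge0 ?sqr_ge0.
Qed.

(** The factor [n.+1] of the Bergman kernel costs one more increment [d] of the
    ratio: the left-hand side is a term of the binomial expansion of the
    right-hand side. *)
Lemma ler_natS_geometric n : n.+1%:R * d * s ^+ n <= (s + d) ^+ n.+1.
Proof.
elim: n => [|n IH]; first by rewrite expr0 mulr1 mul1r expr1 lerDr.
have -> : n.+2%:R * d * s ^+ n.+1 = s * (n.+1%:R * d * s ^+ n) + d * s ^+ n.+1.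
  by rewrite exprS -[n.+2]addn1 natrD; ring.
rewrite [leRHS]exprS [leRHS]mulrDl lerD// ler_wpM2l// lerXn2r ?nnegrE//.
  by rewrite addr_ge0.
by rewrite lerDl.
Qed.

End Bounds.

(** The Leibniz rule for [p * p ^+ n], while [dpow1] is defined from
    [p ^+ n * p]; this form lets the sum over the basis act on [v * p ^+ n * v]. *)
Lemma dpow1Sl v p n : dpow1 v p n.+1 = v * p ^+ n + p * dpow1 v p n.
Proof.
elim: n => [|n IH]; first by rewrite /= !expr0 mulr1 mul1r mulr0 mul0r addrC.
transitivity (dpow1 v p n.+1 * p + p ^+ n.+1 * v); first by [].
rewrite [in LHS]IH /= mulrDl mulrDr !mulrA.
by rewrite -[v * p ^+ n * p]mulrA -exprSr -exprS addrA.
Qed.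

Lemma sum_dpow1_basis q n :
  \sum_(i < 4) dpow1 (delta_mx 0 i) q n * (delta_mx 0 i : quat R) =
  (- 2) *: \sum_(j < n) q ^+ (n.-1 - j) * qconj q ^+ j.
Proof.
elim: n => [|n IH].
  by rewrite big_ord0 scaler0 big1// => i _; rewrite mul0r.
rewrite (eq_bigr (fun i => (delta_mx 0 i : quat R) * q ^+ n * delta_mx 0 i +
    q * (dpow1 (delta_mx 0 i) q n * delta_mx 0 i))); last first.
  by move=> i _; rewrite dpow1Sl mulrDl -!mulrA.
rewrite big_split/= -mulr_sumr IH sum_basis_conj -scalerAr -scalerDr.
congr (_ *: _).
rewrite big_ord_recr/= subnn expr0 mul1r addrC qconjX; congr (_ + _).
rewrite mulr_sumr; apply: eq_bigr => j _; rewrite mulrA -exprS.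
by congr (_ ^+ _ * _); case: n j {IH} => [[]//|n] j; rewrite /= subSn// -ltnS.
Qed.

(** The left-hand side is the Laplacian of [q ^+ n.+1]: both sides satisfy the
    same recursion, by the Leibniz rule and [sum_dpow1_basis]. *)
Lemma sum_dpow2_basis q n :
  \sum_(i < 4) dpow2 (delta_mx 0 i) q n.+1 =
  (- 4) *: \sum_(j < n) ((n - j)%:R : R) *: (q ^+ (n.-1 - j) * qconj q ^+ j).
Proof.
have rec m : \sum_(i < 4) dpow2 (delta_mx 0 i) q m.+1 =
    (\sum_(i < 4) dpow2 (delta_mx 0 i) q m) * q +
    (- 4) *: \sum_(j < m) q ^+ (m.-1 - j) * qconj q ^+ j.
  rewrite /= big_split/= mulr_suml -scaler_sumr sum_dpow1_basis scalerA.
  by congr (_ + _ *: _); ring.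
elim: n => [|n IH].
  by rewrite rec !big_ord0 !scaler0 addr0 big1 ?mul0r.
rewrite rec IH -scalerAl -scalerDr; congr (_ *: _).
rewrite !big_ord_recr/= addrA; congr (_ + _); last first.
  by rewrite subSn// subnn scale1r.
rewrite mulr_suml -big_split/=; apply: eq_bigr => j _.
have qqC : GRing.comm (qconj q ^+ j) q.
  by apply/commr_sym/commrX; exact: qconj_comm.
rewrite -scalerAl -mulrA qqC mulrA -exprSr.
have -> : (n.-1 - j).+1 = (n - j)%N.
  by case: n j {IH qqC} => [[]//|n] j; rewrite /= subSn// -ltnS.
by rewrite subSn ?(ltnW (ltn_ord j))// -natr1 scalerDl scale1r.
Qed.

Lemma sum_dpow2_Qpoly q k :
  \sum_(i < 4) dpow2 (delta_mx 0 i) q k.+2 = (- 2 * (k.+1 * k.+2)%:R) *: Qpoly k q.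
Proof.
rewrite sum_dpow2_basis /Qpoly big_mkord !scaler_sumr.
apply: eq_bigr => j _; rewrite !scalerA; congr (_ *: _).
have jk : (j <= k)%N by exact: (ltn_ord j).
have N0 : (k.+1 * k.+2)%:R != 0 :> R by rewrite pnatr_eq0.
have rearrange (N m : R) : N != 0 -> - 4 * m = - 2 * N * (2 * m / N).
  by move=> ?; field.
by rewrite (subSn jk) addn1 [(2 * _)%:R]natrM; exact: rearrange.
Qed.

End PowerDerivatives.

(** * Termwise differentiation of the Bergman kernel *)

Section TermwiseDerivative.
Context {R : realType}.

(** A series may be differentiated termwise along [v] as soon as its
    first-order Taylor remainders are quadratic, with summable constants: the
    difference quotient of the sum then differs from the sum of the derivatives
    by at most [`|t|] times the sum of these constants. *)
Lemma is_derive_series (V : normedModType R) (W : completeNormedModType R)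
    (f : nat -> V -> W) (f' : nat -> W) (M : nat -> R) (p v : V) :
  cvgn (series (f ^~ p)) -> cvgn (series f') -> cvgn (series M) ->
  (forall n, 0 <= M n) ->
  (\forall t \near (0 : R), cvgn (series (f ^~ (t *: v + p))) /\
    forall n, `|f n (t *: v + p) - f n p - t *: f' n| <= t ^+ 2 * M n) ->
  is_derive p v (fun p => limn (series (f ^~ p))) (limn (series f')).
Proof.
move=> cf cf' cM M_ge0 fM.
suff H : (fun t : R => t^-1 *:
    (limn (series (f ^~ (t *: v + p))) - limn (series (f ^~ p)))) @ 0^' -->
    limn (series f').
  split; last exact: cvg_lim.
  by apply/cvg_ex; exists (limn (series f')).
have M0 : 0 <= limn (series M).
  apply: limr_ge => //; near=> n; exact: sumr_ge0.
apply/cvgrPdist_le => e e0; near=> t.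
have t0 : t != 0 by near: t; exact: nbhs_dnbhs_neq.
have [ct fMt] : cvgn (series (f ^~ (t *: v + p))) /\
    forall n, `|f n (t *: v + p) - f n p - t *: f' n| <= t ^+ 2 * M n.
  near: t; exact: (@nbhs_dnbhs _ (0 : R)).
pose r n := f n (t *: v + p) - f n p - t *: f' n.
have cr : series r @ \oo --> limn (series (f ^~ (t *: v + p)))
    - limn (series (f ^~ p)) - t *: limn (series f').
  rewrite (_ : series r = fun n => series (f ^~ (t *: v + p)) n
    - series (f ^~ p) n - t *: series f' n); last first.
    by apply/funext => n; rewrite /series/= !sumrB scaler_sumr.
  by apply: cvgB; [apply: cvgB|apply: cvgZl_tmp].
rewrite distrC (_ : _ - _ = t^-1 *: limn (series r)); last first.
  by rewrite (cvg_lim _ cr)// [RHS]scalerBr scalerA mulVf// scale1r.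
have nr : cvgn [normed series r].
  apply: (@series_le_cvg _ _ (fun n => t ^+ 2 * M n)) => //.
  - by move=> n; exact: normr_ge0.
  - by move=> n; rewrite mulr_ge0 ?sqr_ge0.
  - rewrite (_ : series _ = t ^+ 2 *: series M); first exact: is_cvgZl_tmp.
    by apply/funext => n; rewrite /series/= -mulr_sumr.
rewrite normrZ normfV.
have rM : limn [normed series r] <= t ^+ 2 * limn (series M).
  have cM2 : (fun n => t ^+ 2 * series M n) @ \oo --> t ^+ 2 * limn (series M).
    by apply: cvgM => //; exact: cvg_cst.
  rewrite -(cvg_lim _ cM2)//; apply: ler_lim => //; first exact: cvgP cM2.
  near=> n; rewrite /series/= mulr_sumr.
  by apply: ler_sum => k _; exact: fMt.
rewrite mulrC ler_pdivrMr ?normr_gt0//.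
apply: le_trans (lim_series_norm nr) _; apply: le_trans rM _.
rewrite -real_normK ?num_real// expr2 mulrAC ler_wpM2r//.
have : `|t| < e / (limn (series M) + 1).
  near: t; apply: dnbhs0_lt.
  by rewrite divr_gt0// ltr_wpDl.
rewrite ltr_pdivlMr ?ltr_wpDl// mulrDr mulr1 => h.
by apply: ltW; apply: le_lt_trans h; rewrite lerDl.
Unshelve. all: by end_near. Qed.

End TermwiseDerivative.

Section BergmanFueterSeries.
Context {R : realType}.
Implicit Types p q r v s : quat R.

Lemma cvg_series_qnorm (u : nat -> quat R) (M : nat -> R) :
  (forall n, qnorm (u n) <= M n) -> cvgn (series M) -> cvgn (series u).
Proof.
move=> uM cM; apply: normed_cvg; apply: series_le_cvg cM => [n|n|n] /=.
- exact: normr_ge0.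
- by apply: le_trans (uM n); exact: qnorm_ge0.
- by apply: le_trans (uM n); exact: ler_norm_qnorm.
Qed.

(** Together with [ler_norm_qnorm], this compares the modulus with the sup norm
    that defines the topology. *)
Lemma qnorm_le_norm p : qnorm p <= 2 * `|p|.
Proof.
rewrite -ler_sqr ?nnegrE ?qnorm_ge0 ?mulr_ge0// exprMn qnorm_sqr.
have c i : p 0 i ^+ 2 <= `|p| ^+ 2.
  rewrite -[p 0 i ^+ 2]real_normK ?num_real// ler_sqr ?nnegrE//.
  by rewrite {2}/Num.norm/= mx_normrE; exact: (le_bigmax _ _ (0, i)).
by have := c 0; have := c 1; have := c 2; have := c 3; lra.
Qed.

Lemma near_qnorm_lt p (rho : R) : qnorm p < rho ->
  \forall p' \near p, qnorm p' < rho.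
Proof.
move=> prho; near=> p'.
rewrite -[p'](subrK p) (le_lt_trans (qnormD _ _))// -ltrBrDr.
apply: le_lt_trans (qnorm_le_norm _) _.
rewrite mulrC -ltr_pdivlMr// distrC; near: p'.
have /cvgr_dist_lt : p' @[p' --> p] --> p by exact: cvg_id.
by apply; rewrite divr_gt0// subr_gt0.
Unshelve. all: by end_near. Qed.

Definition bergman_term s p n : quat R := (n.+1%:R : R) *: (p ^+ n * s ^+ n).

Definition bergman_term1 s v p n : quat R :=
  (n.+1%:R : R) *: (dpow1 v p n * s ^+ n).

Definition bergman_term2 s v p n : quat R :=
  (n.+1%:R : R) *: (dpow2 v p n * s ^+ n).

Section Convergence.
Variables (rho d : R) (s : quat R).
Hypotheses (rho0 : 0 <= rho) (d0 : 0 < d) (rd1 : rho + d + d < 1).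
Hypothesis s1 : qnorm s <= 1.

Let tau := rho + d + d.

Lemma bergman_majorant_ge0 (c : R) n : 0 <= c -> 0 <= c * (n.+1%:R * (rho + d) ^+ n).
Proof.
by move=> c0; rewrite mulr_ge0// mulr_ge0// exprn_ge0// addr_ge0// ltW.
Qed.

Lemma cvg_bergman_majorant (c : R) : 0 <= c ->
  cvgn (series (fun n => c * (n.+1%:R * (rho + d) ^+ n))).
Proof.
have tau0 : 0 <= tau by rewrite !addr_ge0// ltW.
move=> c0; apply: (@series_le_cvg _ _ (geometric (c * tau / d) tau)).
- by move=> n; exact: bergman_majorant_ge0.
- move=> n; rewrite /geometric/= mulr_ge0 ?exprn_ge0//.
  by rewrite divr_ge0 ?(ltW d0)// mulr_ge0.
- move=> n; rewrite /geometric/= -!mulrA ler_wpM2l//.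
  rewrite mulrCA -exprS [leRHS]mulrC ler_pdivlMr// mulrAC.
  by rewrite ler_natS_geometric// ltW.
- apply: is_cvg_geometric_series; rewrite ger0_norm//.
Qed.

Lemma qnorm_term_le (c : R) (x : quat R) n :
  qnorm x <= c * (rho + d) ^+ n ->
  qnorm (n.+1%:R *: (x * s ^+ n)) <= c * (n.+1%:R * (rho + d) ^+ n).
Proof.
move=> xc; rewrite qnormZ qnormM qnormX ger0_norm// [leRHS]mulrCA ler_wpM2l//.
apply: le_trans xc; rewrite ler_piMr ?qnorm_ge0//.
by rewrite exprn_ile1// qnorm_ge0.
Qed.

Lemma qnorm_dpow2_le_div v p n : qnorm v = 1 -> qnorm p <= rho ->
  qnorm (dpow2 v p n) <= 2 / d ^+ 2 * (rho + d) ^+ n.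
Proof.
move=> v1 pr; rewrite mulrAC ler_pdivlMr ?exprn_gt0// mulrC.
by apply: qnorm_dpow2_le => //; exact: ltW.
Qed.

Lemma cvg_bergman_term p : qnorm p <= rho -> cvgn (series (bergman_term s p)).
Proof.
move=> pr; apply: cvg_series_qnorm (cvg_bergman_majorant ler01) => n.
apply: qnorm_term_le; rewrite mul1r qnormX lerXn2r ?nnegrE ?qnorm_ge0//.
  by rewrite addr_ge0// ltW.
by rewrite (le_trans pr)// lerDl ltW.
Qed.

Lemma cvg_bergman_term1 v p : qnorm v = 1 -> qnorm p <= rho ->
  cvgn (series (bergman_term1 s v p)).
Proof.
move=> v1 pr.
have d0' : 0 <= d^-1 by rewrite invr_ge0 ltW.
apply: cvg_series_qnorm (cvg_bergman_majorant d0') => n; apply: qnorm_term_le.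
by rewrite mulrC ler_pdivlMr// mulrC; apply: qnorm_dpow1_le => //; exact: ltW.
Qed.

Lemma cvg_bergman_term2 v p : qnorm v = 1 -> qnorm p <= rho ->
  cvgn (series (bergman_term2 s v p)).
Proof.
move=> v1 pr.
have d0' : 0 <= 2 / d ^+ 2 by rewrite divr_ge0// exprn_ge0// ltW.
apply: cvg_series_qnorm (cvg_bergman_majorant d0') => n; apply: qnorm_term_le.
exact: qnorm_dpow2_le_div.
Qed.

Lemma near_segment v p : qnorm v = 1 -> qnorm p < rho ->
  \forall t \near (0 : R), qnorm (p + t *: v) <= rho.
Proof.
move=> v1 pr; near=> t.
apply: le_trans (qnormD _ _) _; rewrite qnormZ v1 mulr1 -lerBrDl ltW//.
by near: t; apply: (@pseudometric_normed_Zmodule.nbhs0_lt _ R); rewrite subr_gt0.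
Unshelve. all: by end_near. Qed.

Lemma is_derive_bergman v p : qnorm v = 1 -> qnorm p < rho ->
  is_derive p v (fun p => limn (series (bergman_term s p)))
    (limn (series (bergman_term1 s v p))).
Proof.
move=> v1 pr.
have d0' : 0 <= (d ^+ 2)^-1 by rewrite invr_ge0 exprn_ge0// ltW.
apply: (is_derive_series (f := fun n p => bergman_term s p n)
  (M := fun n => (d ^+ 2)^-1 * (n.+1%:R * (rho + d) ^+ n))).
- exact: cvg_bergman_term (ltW pr).
- exact: cvg_bergman_term1 (ltW pr).
- exact: cvg_bergman_majorant.
- by move=> n; exact: bergman_majorant_ge0.
near=> t.
have ptr : qnorm (p + t *: v) <= rho by near: t; exact: near_segment.
rewrite addrC; split; first exact: cvg_bergman_term ptr.
move=> n; apply: le_trans (ler_norm_qnorm _) _.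
have -> : bergman_term s (p + t *: v) n - bergman_term s p n
    - t *: bergman_term1 s v p n = n.+1%:R *: (taylor1 v p t n * s ^+ n).
  rewrite /bergman_term /bergman_term1 /taylor1 scalerA mulrC -scalerA -!scalerBr.
  by rewrite scalerAl -!mulrBl.
rewrite [leRHS]mulrA; apply: qnorm_term_le.
rewrite mulrAC ler_pdivlMr ?exprn_gt0// mulrC.
by apply: qnorm_taylor1_le => //; exact: ltW.
Unshelve. all: by end_near. Qed.

Lemma is_derive_bergman1 v p : qnorm v = 1 -> qnorm p < rho ->
  is_derive p v (fun p => limn (series (bergman_term1 s v p)))
    (limn (series (bergman_term2 s v p))).
Proof.
move=> v1 pr.
have d0' : 0 <= 3 / d ^+ 3 by rewrite divr_ge0// exprn_ge0// ltW.
apply: (is_derive_series (f := fun n p => bergman_term1 s v p n)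
  (M := fun n => 3 / d ^+ 3 * (n.+1%:R * (rho + d) ^+ n))).
- exact: cvg_bergman_term1 (ltW pr).
- exact: cvg_bergman_term2 (ltW pr).
- exact: cvg_bergman_majorant.
- by move=> n; exact: bergman_majorant_ge0.
near=> t.
have ptr : qnorm (p + t *: v) <= rho by near: t; exact: near_segment.
rewrite addrC; split; first exact: cvg_bergman_term1 ptr.
move=> n; apply: le_trans (ler_norm_qnorm _) _.
have -> : bergman_term1 s v (p + t *: v) n - bergman_term1 s v p n
    - t *: bergman_term2 s v p n = n.+1%:R *: (taylor2 v p t n * s ^+ n).
  rewrite /bergman_term2 /bergman_term1 /taylor2 scalerA mulrC -scalerA -!scalerBr.
  by rewrite scalerAl -!mulrBl.
rewrite [leRHS]mulrA; apply: qnorm_term_le.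
rewrite mulrA mulrAC ler_pdivlMr ?exprn_gt0// mulrC [t ^+ 2 * 3]mulrC.
by apply: qnorm_taylor2_le => //; exact: ltW.
Unshelve. all: by end_near. Qed.

Lemma derive2_bergman v p : qnorm v = 1 -> qnorm p < rho ->
  'D_v (fun p => 'D_v (fun p => limn (series (bergman_term s p))) p) p =
  limn (series (bergman_term2 s v p)).
Proof.
move=> v1 pr; rewrite -(@derive_val _ _ _ _ _ _ _ (is_derive_bergman1 v1 pr)).
apply: near_eq_derive; near=> p'.
apply: derive_val; apply: is_derive_bergman => //.
by near: p'; exact: near_qnorm_lt.
Unshelve. all: by end_near. Qed.

End Convergence.

Definition laplacian_pow q n : quat R := \sum_(i < 4) dpow2 (delta_mx 0 i) q n.

(** The gap between [qnorm q] and [1] leaves room for three equal increments: a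
    neighbourhood of [q], the Taylor bounds, and the factor [n.+1]. *)
Lemma exists_radius q : qball q ->
  exists rho d, [/\ 0 <= rho, 0 < d, rho + d + d < 1 & qnorm q < rho].
Proof.
rewrite /qball/= => q1; have := qnorm_ge0 q => q0.
exists (qnorm q + (1 - qnorm q) / 4), ((1 - qnorm q) / 4); split; lra.
Qed.

(** With [qnorm r <= 1], the variable [q] alone provides the geometric decay. *)
Lemma bergman_fueter_series q r : qball q -> qnorm r <= 1 ->
  series (fun n => (n.+1%:R : R) *: (laplacian_pow q n * qconj r ^+ n)) @ \oo
    --> bergman_fueter_kernel q r.
Proof.
move=> /exists_radius[rho [d [rho0 d0 rd1 qr]]].
rewrite -qnorm_conj => r1.
rewrite /bergman_fueter_kernel /laplacian.
under eq_bigr do rewrite (derive2_bergman rho0 d0 rd1 r1 (qnorm_delta _) qr).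
have c i := cvg_bergman_term2 rho0 d0 rd1 r1 (qnorm_delta i) (ltW qr).
rewrite (_ : series _ = (fun n =>
    series (bergman_term2 (qconj r) (delta_mx 0 0) q) n +
    series (bergman_term2 (qconj r) (delta_mx 0 1) q) n +
    series (bergman_term2 (qconj r) (delta_mx 0 2) q) n +
    series (bergman_term2 (qconj r) (delta_mx 0 3) q) n)); last first.
  apply/funext => n; rewrite /series/= -!big_split/=.
  by apply: eq_bigr => m _; rewrite /laplacian_pow sum4 !mulrDl !scalerDr.
by rewrite sum4; apply: cvgD => //; apply: cvgD => //; apply: cvgD.
Qed.

(** The majorant does not depend on [r], so it dominates the series on the whole
    disc of a slice. *)
Lemma bergman_fueter_majorant q : qball q ->
  exists2 M : nat -> R, cvgn (series M) &
    forall n, qnorm (n.+1%:R *: laplacian_pow q n) <= M n.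
Proof.
move=> /exists_radius[rho [d [rho0 d0 rd1 qr]]].
have c0 : 0 <= 8 / d ^+ 2 by rewrite divr_ge0// exprn_ge0// ltW.
exists (fun n => 8 / d ^+ 2 * (n.+1%:R * (rho + d) ^+ n)).
  exact: cvg_bergman_majorant.
move=> n; rewrite qnormZ ger0_norm// [leRHS]mulrCA ler_wpM2l//.
have h i := qnorm_dpow2_le_div rho0 d0 n (qnorm_delta i) (ltW qr).
rewrite /laplacian_pow sum4.
set B := 2 / d ^+ 2 * (rho + d) ^+ n in h.
have -> : 8 / d ^+ 2 * (rho + d) ^+ n = B + B + B + B by rewrite /B; ring.
do 3!(apply: le_trans (qnormD _ _) _; apply: lerD; last exact: h).
exact: h.
Qed.

End BergmanFueterSeries.

(** * Integration on the unit disc *)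

Section Disc.
Context {R : realType}.
Notation leb := (@lebesgue_measure R).
Notation leb2 := (lebesgue_measure \x lebesgue_measure)%E.

Definition disc : set (R * R) := [set z | z.1 ^+ 2 + z.2 ^+ 2 < 1].

Definition chord (c : R) : set R := [set x | x ^+ 2 + c ^+ 2 < 1].

(** For [1 < `|c|] the square root of the negative number [1 - c ^+ 2] is [0], and
    both sides are empty. *)
Lemma chordE c : chord c = `]- Num.sqrt (1 - c ^+ 2), Num.sqrt (1 - c ^+ 2)[%classic.
Proof.
apply/seteqP; split => x; rewrite /chord/= in_itv/= -ltr_norml.
  move=> h; rewrite -ltr_sqr ?nnegrE ?sqrtr_ge0// real_normK ?num_real//.
  have c1 : 0 <= 1 - c ^+ 2 by have := sqr_ge0 x; lra.
  by rewrite sqr_sqrtr//; lra.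
move=> h; have s0 := le_lt_trans (normr_ge0 x) h.
have c1 : 0 < 1 - c ^+ 2 by rewrite -sqrtr_gt0.
move: h; rewrite -ltr_sqr ?nnegrE ?sqrtr_ge0// real_normK ?num_real//.
by rewrite sqr_sqrtr ?ltW//; lra.
Qed.

Lemma measurable_disc : measurable disc.
Proof.
rewrite /disc (_ : [set z | _] = [set: R * R] `&`
  ((fun z => z.1 ^+ 2 + z.2 ^+ 2) @^-1` `]-oo, 1[%classic)); last first.
  by apply/seteqP; split => z /=; rewrite in_itv/= => // -[].
have H : measurable_fun setT (fun z : R * R => z.1 ^+ 2 + z.2 ^+ 2).
  by apply: measurable_funD; apply: measurable_funX.
exact: H.
Qed.

Lemma disc_area_integral :
  leb2 disc = (\int[leb]_x (Num.sqrt (1 - x ^+ 2) *+ 2)%:E)%E.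
Proof.
rewrite /product_measure1/=; apply: eq_integral => x _ /=.
rewrite (_ : xsection disc x = chord x); last first.
  by apply/seteqP; split => y; rewrite /xsection/disc/chord/= inE/=
    [y ^+ 2 + _]addrC.
rewrite chordE lebesgue_measure_itv/= lte_fin.
rewrite -subr_gt0 opprK -mulr2n pmulrn_lgt0//.
have [s0|s0] := ltP 0 (Num.sqrt (1 - x ^+ 2)).
  by rewrite -EFinD mulr2n.
have /eqP -> : Num.sqrt (1 - x ^+ 2) == 0 by rewrite eq_le s0 sqrtr_ge0.
by rewrite mul0rn.
Qed.

(** The chord at [x] has length [2 * Num.sqrt (1 - x ^+ 2)]; the substitution
    [x = sin t] turns the area into the integral of [2 * cos t ^+ 2]. *)
Lemma disc_area : leb2 disc = (pi : R)%:E.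
Proof.
rewrite disc_area_integral.
have -> : (\int[leb]_x (Num.sqrt (1 - x ^+ 2) *+ 2)%:E =
    \int[leb]_(x in `[sin (- (pi / 2) : R), sin (pi / 2 : R)])
      (Num.sqrt (1 - x ^+ 2) *+ 2)%:E)%E.
  rewrite [RHS]integral_mkcond; apply: eq_integral => x _.
  rewrite patchE; case: ifPn => //; rewrite notin_setE/= sinN sin_pihalf in_itv/=.
  rewrite -ler_norml => /negP; rewrite -ltNge => x1.
  rewrite ler0_sqrtr ?mul0rn// subr_le0 -real_normK ?num_real//.
  by rewrite exprn_ege1// ltW.
have pi0 : 0 < pi / 2 :> R by rewrite divr_gt0// pi_gt0.
have piN : - (pi / 2) <= pi / 2 :> R by lra.
have dsin : derive1 (@sin R) = cos.
  by apply/funext => x; rewrite derive1E; exact: derive_val.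
rewrite integration_by_substitution_increasing//; last first.
- apply: continuous_subspaceT => x.
  apply: cvgMn; apply: (@continuous_comp _ _ _ (fun x : R => 1 - x ^+ 2) Num.sqrt).
    by apply: cvgB; [exact: cvg_cst|exact: exprn_continuous].
  exact: sqrt_continuous.
- split.
  + by move=> x _; exact: derivable_sin.
  + by apply: cvg_at_right_filter; exact: continuous_sin.
  + by apply: cvg_at_left_filter; exact: continuous_sin.
- by rewrite dsin; apply/cvg_ex; eexists; apply: cvg_at_left_filter; exact: continuous_cos.
- by rewrite dsin; apply/cvg_ex; eexists; apply: cvg_at_right_filter; exact: continuous_cos.
- by rewrite dsin => x _; exact: continuous_cos.
- by move=> x y xI yI xy; rewrite ltr_sin.
rewrite dsin.
pose F (x : R) : R := x + sin x * cos x.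
have dF (x : R) : is_derive x 1 F (cos x ^+ 2 *+ 2).
  rewrite /F; apply: is_derive_eq.
  rewrite /GRing.scale/=; have := cos2Dsin2 x; lra.
transitivity (\int[leb]_(x in `[(- (pi / 2))%R, (pi / 2)%R]) (cos x ^+ 2 *+ 2)%:E)%E.
  apply: eq_integral => x /[!inE]/=; rewrite in_itv/= => xI; congr (_%:E).
  rewrite -[LHS]/(Num.sqrt (1 - sin x ^+ 2) *+ 2 * cos x).
  by rewrite -cos2sin2 sqrtr_sqr ger0_norm ?cos_ge0_pihalf// mulrnAl expr2.
rewrite (@continuous_FTC2 _ _ F).
- rewrite /F sinN cosN cos_pihalf sin_pihalf -EFinB; congr (_%:E); lra.
- by lra.
- apply: continuous_subspaceT => x.
  by apply: cvgMn; apply: cvgM; exact: continuous_cos.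
- have cF : continuous F.
    move=> x; apply/differentiable_continuous; rewrite -derivable1_diffP.
    by case: (dF x).
  split; first by move=> x _; case: (dF x).
  + by apply: cvg_at_right_filter; exact: cF.
  + by apply: cvg_at_left_filter; exact: cF.
- by move=> x _; rewrite derive1E; apply: derive_val.
Qed.

(** The ends of the chord lie on the circle, where the primitive [F] vanishes. *)
Lemma integral_chord_derive (F f : R -> R) (c : R) :
  (forall x : R, is_derive x 1 F (f x)) -> continuous f ->
  (forall x, x ^+ 2 + c ^+ 2 = 1 -> F x = 0) ->
  (\int[leb]_(x in chord c) (f x)%:E = 0)%E.
Proof.
move=> dF cf F0; rewrite chordE.
have cF : continuous F.
  move=> x; apply/differentiable_continuous; rewrite -derivable1_diffP.
  by case: (dF x).
set a := Num.sqrt (1 - c ^+ 2).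
have [a0|a0] := ltP 0 a; last first.
  by rewrite set_itv_ge ?integral_set0// bnd_simp -leNgt; lra.
have aE : a ^+ 2 + c ^+ 2 = 1.
  by rewrite sqr_sqrtr ?subrK// ltW// -sqrtr_gt0.
have ab : - a < a by lra.
rewrite -(@integral_itv_bndoo _ _ _ _ true false); last first.
  apply/measurable_EFinP; apply: measurable_funTS.
  exact: continuous_measurable_fun.
rewrite (@continuous_FTC2 _ _ F)//.
- by rewrite !F0 ?sqrrN// subee.
- exact: continuous_subspaceT.
- split; first by move=> x _; case: (dF x).
  + by apply: cvg_at_right_filter; exact: cF.
  + by apply: cvg_at_left_filter; exact: cF.
- by move=> x _; rewrite derive1E; apply: derive_val.
Qed.

Lemma disc_area_lty : (leb2 disc < +oo)%E.
Proof. by rewrite disc_area ltry. Qed.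

Lemma integral_disc_horizontal (f : R * R -> R) :
  leb2.-integrable disc (EFin \o f) ->
  (forall y, \int[leb]_(x in chord y) (f (x, y))%:E = 0)%E ->
  (\int[leb2]_(z in disc) (f z)%:E = 0)%E.
Proof.
move=> fi f0; rewrite integral_mkcond.
have fi' : leb2.-integrable setT ((EFin \o f) \_ disc).
  exact: (@integrable_mkcond _ _ _ leb2 disc (EFin \o f) measurable_disc).1 fi.
rewrite -(integral21_prod_meas1 fi').
rewrite (eq_integral (cst 0%E)) ?integral0// => y _.
rewrite /fubini_G -[RHS](f0 y) [RHS]integral_mkcond.
by apply: eq_integral => x _; rewrite !patchE/=.
Qed.

Lemma integral_disc_vertical (f : R * R -> R) :
  leb2.-integrable disc (EFin \o f) ->
  (forall x, \int[leb]_(y in chord x) (f (x, y))%:E = 0)%E ->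
  (\int[leb2]_(z in disc) (f z)%:E = 0)%E.
Proof.
move=> fi f0; rewrite integral_mkcond.
have fi' : leb2.-integrable setT ((EFin \o f) \_ disc).
  exact: (@integrable_mkcond _ _ _ leb2 disc (EFin \o f) measurable_disc).1 fi.
rewrite -(integral12_prod_meas1 fi').
rewrite (eq_integral (cst 0%E)) ?integral0// => x _.
rewrite /fubini_F -[RHS](f0 x) [RHS]integral_mkcond.
apply: eq_integral => y _; rewrite !patchE/=.
have -> // : ((x, y) \in disc) = (y \in chord x).
by apply: asbool_equiv_eq; rewrite /disc/chord/= addrC.
Qed.

End Disc.

(** * The divergence theorem for quaternionic polynomials *)

Section QuatPolynomials.
Context {R : realType}.
Notation leb2 := (lebesgue_measure \x lebesgue_measure)%E.

(** Polynomial expressions in two real variables with quaternion coefficients.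
    Keeping them as syntax gives formal derivatives that are expressions again,
    so that differentiability, measurability and boundedness on the disc all
    follow by induction. *)
Inductive bipoly : Type :=
| Cst of quat R
| VarX
| VarY
| Padd of bipoly & bipoly
| Pmul of bipoly & bipoly.

Fixpoint peval e (z : R * R) : quat R :=
  match e with
  | Cst c => c
  | VarX => z.1 *: 1
  | VarY => z.2 *: 1
  | Padd e1 e2 => peval e1 z + peval e2 z
  | Pmul e1 e2 => peval e1 z * peval e2 z
  end.

Fixpoint pdx e : bipoly :=
  match e with
  | Cst c => Cst 0
  | VarX => Cst 1
  | VarY => Cst 0
  | Padd e1 e2 => Padd (pdx e1) (pdx e2)
  | Pmul e1 e2 => Padd (Pmul (pdx e1) e2) (Pmul e1 (pdx e2))
  end.

Fixpoint pdy e : bipoly :=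
  match e with
  | Cst c => Cst 0
  | VarX => Cst 0
  | VarY => Cst 1
  | Padd e1 e2 => Padd (pdy e1) (pdy e2)
  | Pmul e1 e2 => Padd (Pmul (pdy e1) e2) (Pmul e1 (pdy e2))
  end.

Lemma ord4_ind (P : 'I_4 -> Prop) : P 0 -> P 1 -> P 2 -> P 3 -> forall i, P i.
Proof.
move=> P0 P1 P2 P3 [[|[|[|[|//]]]] lti].
- by rewrite (_ : Ordinal lti = 0) //; apply/val_inj.
- by rewrite (_ : Ordinal lti = 1) //; apply/val_inj.
- by rewrite (_ : Ordinal lti = 2) //; apply/val_inj.
- by rewrite (_ : Ordinal lti = 3) //; apply/val_inj.
Qed.

Definition is_qderive (x : R) (F : R -> quat R) (dF : quat R) :=
  forall i, is_derive x 1 (fun t => F t 0 i) (dF 0 i).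

Lemma is_qderiveD x F G dF dG : is_qderive x F dF -> is_qderive x G dG ->
  is_qderive x (fun t => F t + G t) (dF + dG).
Proof.
move=> hF hG i; rewrite quatD.
under [X in is_derive _ _ X]eq_fun do rewrite quatD.
exact: is_deriveD.
Qed.

Lemma is_qderiveM x F G dF dG : is_qderive x F dF -> is_qderive x G dG ->
  is_qderive x (fun t => F t * G t) (dF * G x + F x * dG).
Proof.
rewrite /is_qderive => hF hG; elim/ord4_ind; rewrite !quatE.
all: under [X in is_derive _ _ X]eq_fun do rewrite quatM.
all: apply: is_derive_eq; rewrite /GRing.scale/=; ring.
Qed.

Lemma is_qderive_cst x (c : quat R) : is_qderive x (fun=> c) 0.
Proof. by move=> i; rewrite quat0; exact: is_derive_cst. Qed.

Lemma is_qderive_id x : is_qderive x (fun t => t *: 1) 1.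
Proof.
elim/ord4_ind; rewrite !quat1.
all: under [X in is_derive _ _ X]eq_fun do rewrite quatZ quat1 ?mulr1 ?mulr0.
all: by [exact: is_derive_id | exact: is_derive_cst].
Qed.

Lemma is_qderive_pdx e y x :
  is_qderive x (fun t => peval e (t, y)) (peval (pdx e) (x, y)).
Proof.
elim: e => /= [c|||e1 h1 e2 h2|e1 h1 e2 h2].
- exact: is_qderive_cst.
- exact: is_qderive_id.
- exact: is_qderive_cst.
- exact: is_qderiveD.
- exact: is_qderiveM.
Qed.

Lemma is_qderive_pdy e x y :
  is_qderive y (fun t => peval e (x, t)) (peval (pdy e) (x, y)).
Proof.
elim: e => /= [c|||e1 h1 e2 h2|e1 h1 e2 h2].
- exact: is_qderive_cst.
- exact: is_qderive_cst.
- exact: is_qderive_id.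
- exact: is_qderiveD.
- exact: is_qderiveM.
Qed.

Lemma measurable_peval e i : measurable_fun [set: R * R] (fun z => peval e z 0 i).
Proof.
move: i; elim: e => /= [c|||e1 h1 e2 h2|e1 h1 e2 h2] i.
- exact: measurable_cst.
- by under eq_fun do rewrite quatZ; apply: measurable_funM.
- by under eq_fun do rewrite quatZ; apply: measurable_funM.
- by under eq_fun do rewrite quatD; exact: measurable_funD.
- move: i; elim/ord4_ind; under eq_fun do rewrite quatM.
  all: do 3?[apply: measurable_funB | apply: measurable_funD].
  all: exact: measurable_funM.
Qed.

Lemma peval_bounded e : exists M, forall z, disc z -> qnorm (peval e z) <= M.
Proof.
have coord_le (a b : R) : a ^+ 2 + b ^+ 2 < 1 -> `|a| <= 1.
  move=> h; rewrite -ler_sqr ?nnegrE// real_normK ?num_real// expr1n.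
  by have := sqr_ge0 b; lra.
elim: e => [c|||e1 [M1 h1] e2 [M2 h2]|e1 [M1 h1] e2 [M2 h2]].
- by exists (qnorm c).
- by exists 1 => -[x y] /coord_le; rewrite /= qnormZ qnorm1 mulr1.
- by exists 1 => -[x y]; rewrite /disc/= addrC => /coord_le;
    rewrite /= qnormZ qnorm1 mulr1.
- exists (M1 + M2) => z zD /=; apply: le_trans (qnormD _ _) _.
  by rewrite lerD ?h1 ?h2.
- exists (M1 * M2) => z zD /=; rewrite qnormM.
  by rewrite ler_pM ?qnorm_ge0 ?h1 ?h2.
Qed.

Lemma integrable_peval e i :
  leb2.-integrable disc (EFin \o (fun z => peval e z 0 i)).
Proof.
apply: measurable_bounded_integrable.
- exact: measurable_disc.
- exact: disc_area_lty.
- by apply: measurable_funTS; exact: measurable_peval.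
have [M hM] := peval_bounded e.
exists M; split; first exact: num_real.
move=> B MB z zD /=; apply: le_trans (ler_coord_qnorm _ _) _.
exact: le_trans (hM _ zD) (ltW MB).
Qed.

Lemma continuous_qderive (F dF : R -> quat R) i :
  (forall x, is_qderive x F (dF x)) -> continuous (fun t => F t 0 i).
Proof.
move=> h x; apply/differentiable_continuous; rewrite -derivable1_diffP.
by case: (h x i).
Qed.

(** The divergence theorem on the disc, for fields that vanish on the circle:
    integrate along the chords, where the derivative has a primitive that
    vanishes at both ends. *)
Lemma integral_disc_pdx e i :
  (forall z, z.1 ^+ 2 + z.2 ^+ 2 = 1 -> peval e z = 0) ->
  (\int[leb2]_(z in disc) (peval (pdx e) z 0 i)%:E = 0)%E.
Proof.
move=> e0; apply: integral_disc_horizontal => [|y]; first exact: integrable_peval.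
apply: (@integral_chord_derive _ (fun t => peval e (t, y) 0 i)).
- by move=> x; exact: is_qderive_pdx.
- apply: (@continuous_qderive _ (fun x => peval (pdx (pdx e)) (x, y))) => x.
  exact: is_qderive_pdx.
- by move=> x xy; rewrite e0 ?quat0.
Qed.

Lemma integral_disc_pdy e i :
  (forall z, z.1 ^+ 2 + z.2 ^+ 2 = 1 -> peval e z = 0) ->
  (\int[leb2]_(z in disc) (peval (pdy e) z 0 i)%:E = 0)%E.
Proof.
move=> e0; apply: integral_disc_vertical => [|x]; first exact: integrable_peval.
apply: (@integral_chord_derive _ (fun t => peval e (x, t) 0 i)).
- by move=> y; exact: is_qderive_pdy.
- apply: (@continuous_qderive _ (fun y => peval (pdy (pdy e)) (x, y))) => y.
  exact: is_qderive_pdy.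
- by move=> y xy; rewrite e0 ?quat0//= addrC.
Qed.

End QuatPolynomials.

(** * Moments of the disc of a slice *)

Section Moments.
Context {R : realType}.
Notation leb2 := (lebesgue_measure \x lebesgue_measure)%E.
Notation integrable_disc f := (leb2.-integrable disc (EFin \o f)).

Lemma integrable_lin (a b : R) (f g : R * R -> R) :
  integrable_disc f -> integrable_disc g ->
  integrable_disc (fun z => a * f z + b * g z).
Proof.
move=> fi gi.
have -> : EFin \o (fun z => a * f z + b * g z) =
    (fun z => (a%:E * (EFin \o f) z) + (b%:E * (EFin \o g) z))%E by [].
by apply: integrableD; [exact: measurable_disc|..];
  apply: integrableZl => //; exact: measurable_disc.
Qed.

Lemma Rintegral_lin (a b : R) (f g : R * R -> R) :
  integrable_disc f -> integrable_disc g ->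
  \int[leb2]_(z in disc) (a * f z + b * g z) =
  a * (\int[leb2]_(z in disc) f z) + b * (\int[leb2]_(z in disc) g z).
Proof.
move=> fi gi; have mD := @measurable_disc R.
rewrite -!RintegralZl// RintegralD//.
- exact: (@integrableZl _ _ _ leb2 disc mD a (EFin \o f) fi).
- exact: (@integrableZl _ _ _ leb2 disc mD b (EFin \o g) gi).
Qed.

Definition qint (F : R * R -> quat R) : quat R :=
  \row_(i < 4) \int[leb2]_(z in disc) F z 0 i.

Definition qintegrable (F : R * R -> quat R) :=
  forall i, integrable_disc (fun z => F z 0 i).

Lemma qintegrable_peval e : qintegrable (peval e).
Proof. exact: integrable_peval. Qed.

Lemma qintE F i : qint F 0 i = \int[leb2]_(z in disc) F z 0 i.
Proof. exact: mxE. Qed.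

Lemma qint_lin (a b : R) F G : qintegrable F -> qintegrable G ->
  qint (fun z => a *: F z + b *: G z) = a *: qint F + b *: qint G.
Proof.
move=> Fi Gi; apply: quat_coordP => i.
rewrite quatD !quatZ !qintE -Rintegral_lin//.
by congr Rintegral; apply/funext => z; rewrite quatD !quatZ.
Qed.

Lemma qintD F G : qintegrable F -> qintegrable G ->
  qint (fun z => F z + G z) = qint F + qint G.
Proof.
move=> Fi Gi; rewrite -[qint F]scale1r -[qint G]scale1r -qint_lin//.
by congr qint; apply/funext => z; rewrite !scale1r.
Qed.

Lemma qintMl (c : quat R) F : qintegrable F -> qint (fun z => c * F z) = c * qint F.
Proof.
move=> Fi.
have lin4 (a0 a1 a2 a3 : R) : \int[leb2]_(z in disc)
   (a0 * F z 0 0 + a1 * F z 0 1 + a2 * F z 0 2 + a3 * F z 0 3) =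
   a0 * qint F 0 0 + a1 * qint F 0 1 + a2 * qint F 0 2 + a3 * qint F 0 3.
  rewrite !qintE -Rintegral_lin//.
  rewrite -[X in X + a2 * _]mul1r -Rintegral_lin//; last exact: integrable_lin.
  rewrite -[X in X + a3 * _]mul1r -Rintegral_lin//.
    by congr Rintegral; apply/funext => z; rewrite !mul1r.
  by apply: integrable_lin => //; exact: integrable_lin.
apply: quat_coordP; elim/ord4_ind; rewrite qintE quatM.
- transitivity (c 0 0 * qint F 0 0 + (- c 0 1) * qint F 0 1 +
    (- c 0 2) * qint F 0 2 + (- c 0 3) * qint F 0 3); last by ring.
  by rewrite -lin4; congr Rintegral; apply/funext => z; rewrite quatM; ring.
- transitivity (c 0 1 * qint F 0 0 + c 0 0 * qint F 0 1 +
    (- c 0 3) * qint F 0 2 + c 0 2 * qint F 0 3); last by ring.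
  by rewrite -lin4; congr Rintegral; apply/funext => z; rewrite quatM; ring.
- transitivity (c 0 2 * qint F 0 0 + c 0 3 * qint F 0 1 +
    c 0 0 * qint F 0 2 + (- c 0 1) * qint F 0 3); last by ring.
  by rewrite -lin4; congr Rintegral; apply/funext => z; rewrite quatM; ring.
- transitivity (c 0 3 * qint F 0 0 + (- c 0 2) * qint F 0 1 +
    c 0 1 * qint F 0 2 + c 0 0 * qint F 0 3); last by ring.
  by rewrite -lin4; congr Rintegral; apply/funext => z; rewrite quatM; ring.
Qed.

Lemma qint_pdx e : (forall z, z.1 ^+ 2 + z.2 ^+ 2 = 1 -> peval e z = 0) ->
  qint (peval (pdx e)) = 0.
Proof.
move=> e0; apply: quat_coordP => i.
by rewrite qintE /Rintegral integral_disc_pdx// quat0.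
Qed.

Lemma qint_pdy e : (forall z, z.1 ^+ 2 + z.2 ^+ 2 = 1 -> peval e z = 0) ->
  qint (peval (pdy e)) = 0.
Proof.
move=> e0; apply: quat_coordP => i.
by rewrite qintE /Rintegral integral_disc_pdy// quat0.
Qed.

(** The expression of the point [x + y c] of the slice of [c]. *)
Definition plin (c : quat R) := Padd VarX (Pmul VarY (Cst c)).

Fixpoint ppow (e : @bipoly R) n := if n is m.+1 then Pmul e (ppow e m) else Cst 1.

Lemma peval_plin c z : peval (plin c) z = slice_pt c z.
Proof. by rewrite /= -scalerAl mul1r. Qed.

Lemma peval_ppow e n z : peval (ppow e n) z = peval e z ^+ n.
Proof. by elim: n => [|n IH] //=; rewrite IH exprS. Qed.

Lemma slice_pt_comm (c : quat R) z : GRing.comm c (slice_pt c z).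
Proof. by apply: quatP; rewrite /slice_pt !quatE; ring. Qed.

Lemma pdx_ppow c n z :
  peval (pdx (ppow (plin c) n)) z = n%:R *: slice_pt c z ^+ n.-1.
Proof.
elim: n => [|n IH]; first by rewrite scale0r.
rewrite -[LHS]/(peval (pdx (plin c)) z * peval (ppow (plin c) n) z +
  peval (plin c) z * peval (pdx (ppow (plin c) n)) z).
rewrite IH peval_ppow peval_plin /= mul0r mulr0 !addr0 mul1r -scalerAr.
case: n {IH} => [|n] /=; first by rewrite scale0r addr0 scale1r.
by rewrite -exprS -[n.+2]addn1 natrD scalerDl scale1r addrC.
Qed.

Lemma pdy_ppow c n z :
  peval (pdy (ppow (plin c) n)) z = n%:R *: (c * slice_pt c z ^+ n.-1).
Proof.
elim: n => [|n IH]; first by rewrite scale0r.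
rewrite -[LHS]/(peval (pdy (plin c)) z * peval (ppow (plin c) n) z +
  peval (plin c) z * peval (pdy (ppow (plin c) n)) z).
rewrite IH peval_ppow peval_plin /= mulr0 mul1r addr0 add0r -scalerAr.
case: n {IH} => [|n] /=; first by rewrite scale0r addr0 scale1r.
rewrite mulrA -slice_pt_comm -mulrA -exprS -[n.+2]addn1 natrD scalerDl scale1r.
by rewrite addrC.
Qed.

Section Slice.
Variable I : quat R.
Hypothesis hI : imag_units I.

Let hI2 : I * I = - 1. Proof. by rewrite -expr2. Qed.

Lemma imag_unit_norm : qnorm I = 1.
Proof.
apply: eq_qnorm => //; rewrite -qnormX hI expr1n -scaleN1r qnormZ qnorm1 mulr1.
by rewrite normrN1.
Qed.

(** Compare the real part of [I * I = - 1] with the squared modulus of [I]. *)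
Lemma imag_unit_Re : I 0 0 = 0.
Proof.
have := congr1 (fun x : quat R => x 0 0) hI2; rewrite !quatE => h.
have := qnorm_sqr I; rewrite imag_unit_norm => n.
by apply/eqP; rewrite -sqrf_eq0; apply/eqP; lra.
Qed.

Lemma slice_pt_conj z : slice_pt (- I) z = qconj (slice_pt I z).
Proof.
by apply: quatP; rewrite /slice_pt !quatE ?imag_unit_Re; ring.
Qed.

Lemma slice_pt_norm z : qnorm (slice_pt I z) ^+ 2 = z.1 ^+ 2 + z.2 ^+ 2.
Proof.
have := qnorm_sqr I; rewrite imag_unit_norm imag_unit_Re => n.
rewrite qnorm_sqr /slice_pt !quatE imag_unit_Re.
have -> : z.2 ^+ 2 = z.2 ^+ 2 * (I 0 1 ^+ 2 + I 0 2 ^+ 2 + I 0 3 ^+ 2).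
  by rewrite -[LHS]mulr1; congr (_ * _); lra.
by ring.
Qed.

Lemma slice_pt_mul_conj z :
  slice_pt I z * qconj (slice_pt I z) = (z.1 ^+ 2 + z.2 ^+ 2) *: 1.
Proof.
rewrite -slice_pt_norm qnorm_sqr.
by apply: quatP; rewrite !quatE; ring.
Qed.

Definition mono a b := Pmul (ppow (plin I) a) (ppow (plin (- I)) b).

Definition slice_mono a b z := slice_pt I z ^+ a * qconj (slice_pt I z) ^+ b.

Lemma peval_mono a b : peval (mono a b) = slice_mono a b.
Proof.
apply/funext => z; rewrite /mono [LHS]/= !peval_ppow !peval_plin.
by rewrite slice_pt_conj.
Qed.

Lemma slice_pt_conj_comm z : GRing.comm (slice_pt I z) (qconj (slice_pt I z)).
Proof. exact: qconj_comm. Qed.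

Lemma pdx_mono a b z : peval (pdx (mono a b)) z =
  a%:R *: slice_mono a.-1 b z + b%:R *: slice_mono a b.-1 z.
Proof.
rewrite -[LHS]/(peval (pdx (ppow (plin I) a)) z * peval (ppow (plin (- I)) b) z +
  peval (ppow (plin I) a) z * peval (pdx (ppow (plin (- I)) b)) z).
rewrite !pdx_ppow !peval_ppow !peval_plin slice_pt_conj.
by rewrite -scalerAl -scalerAr.
Qed.

Lemma pdy_mono a b z : peval (pdy (mono a b)) z =
  I * (a%:R *: slice_mono a.-1 b z - b%:R *: slice_mono a b.-1 z).
Proof.
rewrite -[LHS]/(peval (pdy (ppow (plin I) a)) z * peval (ppow (plin (- I)) b) z +
  peval (ppow (plin I) a) z * peval (pdy (ppow (plin (- I)) b)) z).
rewrite !pdy_ppow !peval_ppow !peval_plin slice_pt_conj /slice_mono.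
rewrite -scalerAl -scalerAr mulNr mulrN scalerN mulrBr -!scalerAr.
congr (_ *: _ - _ *: _); first by rewrite mulrA.
by rewrite !mulrA; congr (_ * _); apply/esym/commrX; exact: slice_pt_comm.
Qed.

(** [(1 - qnorm w ^+ 2) * w ^+ a * qconj w ^+ b], which vanishes on the circle. *)
Definition cutoff_mono a b :=
  Padd (mono a b) (Pmul (Cst (- 1)) (mono a.+1 b.+1)).

Lemma cutoff_mono0 a b z : z.1 ^+ 2 + z.2 ^+ 2 = 1 ->
  peval (cutoff_mono a b) z = 0.
Proof.
move=> z1; rewrite -[LHS]/(peval (mono a b) z + - 1 * peval (mono a.+1 b.+1) z).
rewrite !peval_mono /slice_mono exprSr [qconj _ ^+ b.+1]exprS mulrA.
rewrite -[_ * _ * qconj (slice_pt I z)]mulrA slice_pt_mul_conj z1 scale1r mulr1.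
by rewrite mulN1r subrr.
Qed.

Definition moment a b := qint (slice_mono a b).

Lemma qintegrable_mono a b : qintegrable (slice_mono a b).
Proof. by rewrite -peval_mono; exact: qintegrable_peval. Qed.

Lemma qint_wirtinger a b (eps : R) :
  qint (fun z => peval (pdx (cutoff_mono a b)) z +
    (eps *: I) * peval (pdy (cutoff_mono a b)) z) = 0.
Proof.
rewrite (qintD (F := peval (pdx (cutoff_mono a b)))
  (G := fun z => eps *: I * peval (pdy (cutoff_mono a b)) z)).
- rewrite qintMl; last exact: qintegrable_peval.
  by rewrite qint_pdx ?qint_pdy ?mulr0 ?addr0//; exact: cutoff_mono0.
- exact: qintegrable_peval.
- exact: (@qintegrable_peval (Pmul (Cst (eps *: I)) (pdy (cutoff_mono a b)))).
Qed.

Lemma pdx_cutoff a b z : peval (pdx (cutoff_mono a b)) z =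
  peval (pdx (mono a b)) z - peval (pdx (mono a.+1 b.+1)) z.
Proof.
rewrite -[LHS]/(_ + (0 * peval (mono a.+1 b.+1) z +
  - 1 * peval (pdx (mono a.+1 b.+1)) z)).
by rewrite mul0r add0r mulN1r.
Qed.

Lemma pdy_cutoff a b z : peval (pdy (cutoff_mono a b)) z =
  peval (pdy (mono a b)) z - peval (pdy (mono a.+1 b.+1)) z.
Proof.
rewrite -[LHS]/(_ + (0 * peval (mono a.+1 b.+1) z +
  - 1 * peval (pdy (mono a.+1 b.+1)) z)).
by rewrite mul0r add0r mulN1r.
Qed.

(** For [eps = - 1] and [eps = 1] only one of the two brackets survives: up to
    the factor [2], these are the two Wirtinger derivatives. *)
Lemma wirtinger_cutoff a b (eps : R) z :
  peval (pdx (cutoff_mono a b)) z + (eps *: I) * peval (pdy (cutoff_mono a b)) z =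
  (1 - eps) *: (a%:R *: slice_mono a.-1 b z - a.+1%:R *: slice_mono a b.+1 z) +
  (1 + eps) *: (b%:R *: slice_mono a b.-1 z - b.+1%:R *: slice_mono a.+1 b z).
Proof.
rewrite pdx_cutoff pdy_cutoff !pdx_mono !pdy_mono /= -mulrBr -scalerAl mulrA hI2.
rewrite mulN1r.
move: (slice_mono _ _ _) (slice_mono _ _ _) (slice_mono _ _ _)
  (slice_mono _ _ _) => u v w t.
by apply: quatP; rewrite !quatE; ring.
Qed.

Lemma momentSl a b : a.+1%:R *: moment a b = a.+2%:R *: moment a.+1 b.+1.
Proof.
have := qint_wirtinger a.+1 b (- 1).
rewrite (_ : (fun z => _) = (fun z => (2 * a.+1%:R) *: slice_mono a b z +
  (- (2 * a.+2%:R)) *: slice_mono a.+1 b.+1 z)); last first.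
  apply/funext => z; rewrite wirtinger_cutoff addrN scale0r addr0 opprK.
  by rewrite scalerBr !scalerA scaleNr.
rewrite qint_lin; try exact: qintegrable_mono.
move=> h; apply: quat_coordP => i.
have := congr1 (fun x : quat R => x 0 i) h.
rewrite /= !quatE /moment => {}h; lra.
Qed.

Lemma momentSr a b : b.+1%:R *: moment a b = b.+2%:R *: moment a.+1 b.+1.
Proof.
have := qint_wirtinger a b.+1 1.
rewrite (_ : (fun z => _) = (fun z => (2 * b.+1%:R) *: slice_mono a b z +
  (- (2 * b.+2%:R)) *: slice_mono a.+1 b.+1 z)); last first.
  apply/funext => z; rewrite wirtinger_cutoff subrr scale0r add0r.
  by rewrite scalerBr !scalerA scaleNr.
rewrite qint_lin; try exact: qintegrable_mono.
move=> h; apply: quat_coordP => i.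
have := congr1 (fun x : quat R => x 0 i) h.
rewrite /= !quatE /moment => {}h; lra.
Qed.

(** The relations [momentSl] and [momentSr] are two linear equations in the
    moments at [(a, b)] and [(a.+1, b.+1)], of determinant [b - a]. *)
Lemma moment_neq a b : a != b -> moment a b = 0.
Proof.
move=> ab; apply: quat_coordP => i.
have := congr1 (fun x : quat R => x 0 i) (momentSl a b).
have := congr1 (fun x : quat R => x 0 i) (momentSr a b).
rewrite /= !quatE -!natr1.
move: (moment a b 0 i) (moment a.+1 b.+1 0 i) => m m' hb ha.
have ab0 : a%:R - b%:R != 0 :> R by rewrite subr_eq0 eqr_nat.
have mm : m = m' by apply: (mulfI ab0); lra.
by move: ha; rewrite -mm => ha; lra.
Qed.

Lemma moment00 : moment 0 0 = pi *: 1.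
Proof.
apply: quat_coordP => i; rewrite qintE quatZ.
transitivity (\int[leb2]_(z in disc) ((1 : quat R) 0 i)).
  by congr Rintegral; apply/funext => z; rewrite /slice_mono !expr0 mulr1.
rewrite Rintegral_cst; last exact: measurable_disc.
by rewrite [X in fine X](_ : _ = pi%:E) 1?mulrC//; exact: disc_area.
Qed.

Lemma moment_eq n : n.+1%:R *: moment n n = pi *: 1.
Proof.
elim: n => [|n IH]; first by rewrite scale1r moment00.
by rewrite -momentSl.
Qed.

End Slice.
End Moments.

(** * Termwise integration *)

Section SliceProjection.
Context {R : realType}.
Notation leb2 := (lebesgue_measure \x lebesgue_measure)%E.
Variables (I : quat R) (hI : imag_units I).

Fixpoint mono_sum (c : nat -> quat R) m n : @bipoly R :=
  if n is n'.+1 then Padd (mono_sum c m n') (Pmul (Cst (c n')) (mono I m n'))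
  else Cst 0.

Lemma peval_mono_sum c m n z : peval (mono_sum c m n) z =
  (\sum_(0 <= j < n) c j * qconj (slice_pt I z) ^+ j) * slice_pt I z ^+ m.
Proof.
elim: n => [|n IH]; first by rewrite big_geq// mul0r.
rewrite -[LHS]/(peval (mono_sum c m n) z + c n * peval (mono I m n) z).
rewrite IH peval_mono// big_nat_recr//= mulrDl /slice_mono -[in RHS]mulrA.
congr (_ + _ * _); apply/commrX/commr_sym/commrX/commr_sym.
exact: slice_pt_conj_comm.
Qed.

Lemma qint_mono_sum c m n :
  qint (peval (mono_sum c m n)) = \sum_(0 <= j < n) c j * moment I m j.
Proof.
elim: n => [|n IH].
  rewrite big_geq//; apply: quat_coordP => i; rewrite qintE [RHS]quat0/=.
  by rewrite /Rintegral; under eq_integral do rewrite quat0; rewrite integral0.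
rewrite big_nat_recr//= -IH (qintD (F := peval (mono_sum c m n))
  (G := fun z => c n * peval (mono I m n) z)).
- rewrite qintMl; last exact: qintegrable_peval.
  by rewrite peval_mono.
- exact: qintegrable_peval.
- exact: (@qintegrable_peval _ (Pmul (Cst (c n)) (mono I m n))).
Qed.

(** By orthogonality the integral only sees the coefficient [c m], and the
    partial integrals are stationary from rank [m.+1] on. *)
Lemma qint_mono_sum_stationary c m n : (m < n)%N ->
  qint (peval (mono_sum c m n)) = (pi / m.+1%:R) *: c m.
Proof.
move=> mn; rewrite qint_mono_sum big_mkord (bigD1 (Ordinal mn))//= big1 ?addr0.
  have -> : moment I m m = (pi / m.+1%:R) *: 1.
    by rewrite mulrC -scalerA -(moment_eq hI m) scalerA mulVf ?scale1r.
  by rewrite -scalerAr mulr1.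
by move=> j jm; rewrite moment_neq ?mulr0//; apply: contra jm => /eqP mj; apply/eqP/val_inj.
Qed.

Lemma cvg_quat_mulr_coord (u : nat -> quat R) (l c : quat R) i :
  u @ \oo --> l -> (fun n => (u n * c) 0 i) @ \oo --> (l * c) 0 i.
Proof.
move=> ul.
have uc j : (fun n => u n 0 j) @ \oo --> l 0 j.
  exact: (continuous_cvg _ (@coord_continuous _ _ _ 0 j l) ul).
have uM j k : (fun n => u n 0 j * c 0 k) @ \oo --> l 0 j * c 0 k.
  by apply: cvgM => //; exact: cvg_cst.
move: i; elim/ord4_ind; rewrite quatM; under eq_fun do rewrite quatM.
- by do 3!apply: cvgB => //.
- by apply: cvgB => //; do 2!apply: cvgD => //.
- by apply: cvgD => //; apply: cvgD => //; apply: cvgB.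
- by apply: cvgD => //; apply: cvgB => //; apply: cvgD.
Qed.

(** Under a uniform summable majorant of its coefficients, a function given on
    the disc by a power series in [qconj w] may be integrated termwise against
    [w ^+ m]. *)
Lemma qint_series (c : nat -> quat R) (M : nat -> R) (K : R * R -> quat R) m :
  (forall n, qnorm (c n) <= M n) -> cvgn (series M) ->
  (forall z, disc z ->
    series (fun n => c n * qconj (slice_pt I z) ^+ n) @ \oo --> K z) ->
  qint (fun z => K z * slice_pt I z ^+ m) = (pi / m.+1%:R) *: c m.
Proof.
move=> cM M_cvg cK; apply: quat_coordP => i; rewrite qintE.
have M0 n : 0 <= M n by apply: le_trans (cM n); exact: qnorm_ge0.
set f := fun z => (K z * slice_pt I z ^+ m) 0 i.
pose f_ n (z : R * R) := (peval (mono_sum c m n) z 0 i)%:E.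
have f_cvg z : disc z -> f_ ^~ z @ \oo --> (f z)%:E.
  move=> zD; apply: cvg_EFin; first exact: nearW.
  rewrite (_ : fine \o _ = fun n => (series (fun n => c n * qconj (slice_pt I z) ^+ n) n
    * slice_pt I z ^+ m) 0 i); first exact: cvg_quat_mulr_coord (cK _ zD).
  by apply/funext => n; rewrite /= peval_mono_sum.
have f_bound n z : disc z -> (`|f_ n z| <= (limn (series M))%:E)%E.
  rewrite /disc/= => zD; rewrite lee_fin; apply: le_trans (ler_coord_qnorm _ _) _.
  have w1 : qnorm (slice_pt I z) <= 1.
    by rewrite -ler_sqr ?nnegrE ?qnorm_ge0// slice_pt_norm// expr1n ltW.
  rewrite peval_mono_sum qnormM qnormX.
  apply: (@le_trans _ _ (series M n)); last first.
    by apply: nondecreasing_cvgn_le => //; exact: nondecreasing_series.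
  rewrite -[leRHS]mulr1 ler_pM ?qnorm_ge0 ?exprn_ge0 ?exprn_ile1 ?qnorm_ge0//.
  rewrite /series/=; elim: n => [|n IH]; first by rewrite !big_geq// qnorm0.
  rewrite !big_nat_recr//=; apply: le_trans (qnormD _ _) _; rewrite lerD//.
  rewrite qnormM qnormX qnorm_conj; apply: le_trans (cM n).
  by rewrite ler_piMr ?qnorm_ge0// exprn_ile1// qnorm_ge0.
have := @dominated_cvg _ _ _ leb2 disc measurable_disc f_ (EFin \o f)
  (cst (limn (series M))%:E) _ f_cvg _ _ f_bound.
have int_f n : (m < n)%N ->
    (\int[leb2]_(z in disc) f_ n z = (((pi / m.+1%:R) *: c m) 0 i)%:E)%E.
  move=> mn; rewrite -(qint_mono_sum_stationary c mn) qintE fineK//.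
  by apply: integrable_fin_num; [exact: measurable_disc|exact: integrable_peval].
move=> lim_f.
suff : (\int[leb2]_(z in disc) (f z)%:E = (((pi / m.+1%:R) *: c m) 0 i)%:E)%E.
  by rewrite /Rintegral => ->.
apply: (@cvg_unique _ _ ((fun n => \int[leb2]_(z in disc) f_ n z) @ \oo)%E) => //.
  apply: lim_f => //.
  - by move=> n; apply/measurable_EFinP; apply: measurable_funTS; exact: measurable_peval.
  (* A constant is integrable on the disc, as a polynomial. *)
  - have := integrable_peval (Cst (limn (series M) *: 1)) 0.
    by under eq_fun do rewrite [peval _ _]/= quatZ quat1 mulr1.
apply: cvg_near_cst; exists m.+1 => // n /= mn; exact: int_f.
Qed.

Lemma slice_integralE f : slice_integral I f = pi^-1 *: qint (f \o slice_pt I).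
Proof.
apply: quat_coordP => i; rewrite quatZ qintE mxE; congr (_ * _).
congr Rintegral; apply/seteqP; split => z; rewrite /slice_ball/qball/disc/=.
  by rewrite -(slice_pt_norm hI) => -[h _]; rewrite expr_lt1 ?qnorm_ge0.
rewrite -(slice_pt_norm hI) expr_lt1 ?qnorm_ge0// => h; split=> //.
by exists z.
Qed.

End SliceProjection.

(** * The integral representation *)

Theorem proposition6p9 (R : realType) (I q : quat R) (k : nat)
    (hI : imag_units I) (hq : qball q) :
  Qpoly k q = - (2 * (k.+1 * k.+2)%:R)^-1 *:
    slice_integral I (fun r => bergman_fueter_kernel q r * r ^+ k.+2).
Proof.
have [M M_cvg cM] := bergman_fueter_majorant hq.
rewrite slice_integralE//.
rewrite (qint_series (c := fun n => n.+1%:R *: laplacian_pow q n)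
  (K := fun z => bergman_fueter_kernel q (slice_pt I z)) hI k.+2 cM M_cvg); last first.
  move=> z zD; have : qnorm (slice_pt I z) <= 1.
    by rewrite -ler_sqr ?nnegrE ?qnorm_ge0// slice_pt_norm// expr1n ltW.
  move=> /(bergman_fueter_series hq).
  by under eq_fun do rewrite scalerAl.
rewrite /laplacian_pow sum_dpow2_Qpoly !scalerA -[LHS]scale1r; congr (_ *: _).
have pi0 : pi != 0 :> R by rewrite gt_eqF// pi_gt0.
have N0 : (k.+1 * k.+2)%:R != 0 :> R by rewrite pnatr_eq0.
have rearrange (p N m : R) : p != 0 -> N != 0 -> m != 0 ->
    1 = - (2 * N)^-1 * p^-1 * (p / m) * m * (- 2 * N).
  by move=> *; field; apply/and3P.
by apply: rearrange => //; rewrite pnatr_eq0.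
Qed.
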